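(* Let $(X,d)$ be a complete metric space, let $k\in\mathbb{N}$, and let $T:\prod_{l=1}^{k}X\to X$ be a Fisher-Geraghty $H_k$ contraction. Then $T$ has a fixed point, i.e. there is $u\in X$ with $T(u,\ldots,u)=u$.
   Context: $\mathbb{N}$ denotes the set of positive integers; metric spaces are nonempty. $\prod_{l=1}^{k}X=X^k$. $\mathbb{G}$ denotes the set of all functions $\beta:[0,\infty)\to[0,1)$ such that, for every sequence $(t_n)$ in $[0,\infty)$, $\lim_{n\to\infty}\beta(t_n)=1$ implies $\lim_{n\to\infty}t_n=0$. Fisher-Geraghty $H_k$ contraction (of dimension $k$): $T:\prod_{l=1}^{k}X\to X$ is so called if there is $\beta\in\mathbb{G}$ such that for all $u_1,\ldots,u_k,v_1,\ldots,v_k\in X$, $$d\big(T(u_1,\ldots,u_k),T(v_1,\ldots,v_k)\big)\le\frac{\beta(d(u_k,v_k))}{2}\Big(d\big(T(u_1,\ldots,u_k),v_k\big)+d\big(T(v_1,\ldots,v_k),u_k\big)\Big).$$ *)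

(* Defs.v *)
From HB Require Import structures.
From mathcomp Require Import all_boot all_order all_algebra.
From mathcomp Require Import boolp classical_sets filter reals topology normedtype sequences.

Set Implicit Arguments.
Unset Strict Implicit.
Unset Printing Implicit Defensive.

Import Order.TTheory GRing.Theory Num.Theory.
Import numFieldNormedType.Exports.

Local Open Scope classical_set_scope.
Local Open Scope ring_scope.

(* [Complete] includes a distinguished point, hence nonemptiness. *)
#[short(type="completeMetricType")]
HB.structure Definition CompleteMetric (R : numDomainType) :=
  {X of Complete X & Metric R X}.

(* The class G of functions [0, +oo[ -> [0, 1[, represented by functions on R
   whose values at negative arguments are irrelevant. *)
Definition geraghty {R : realType} (beta : R -> R) : Prop :=
  (forall t : R, 0 <= t -> 0 <= beta t < 1) /\
  (forall t : nat -> R, (forall n, 0 <= t n) ->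
     beta (t n) @[n --> \oo] --> (1 : R) -> t n @[n --> \oo] --> (0 : R)).

(* The dimension is k.+1, so that it ranges over the positive integers; the
   last coordinate of u : 'I_k.+1 -> X is then u ord_max. *)
Definition fisher_geraghty_H {R : realType} {X : metricType R} (k : nat)
    (T : ('I_k.+1 -> X) -> X) : Prop :=
  exists beta : R -> R, geraghty beta /\
    forall u v : 'I_k.+1 -> X,
      mdist (T u) (T v) <=
        beta (mdist (u ord_max) (v ord_max)) / 2 *
        (mdist (T u) (v ord_max) + mdist (T v) (u ord_max)).

(* Main.v *)
Require Import Defs.
From mathcomp Require Import all_boot all_order all_algebra.
From mathcomp Require Import boolp classical_sets filter reals topology normedtype sequences.
From mathcomp Require Import lra.

Import Order.TTheory GRing.Theory Num.Theory.
Import numFieldNormedType.Exports.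

Local Open Scope ring_scope.

(** On the diagonal, T induces the self-map f x = T (x, ..., x), and the
    hypothesis on T becomes
      d (f x) (f y) <= beta (d x y) / 2 * (d (f x) y + d (f y) x);
    a fixed point of f is what is wanted.

    The class of functions beta enters only through a uniform gap: beta stays
    below some 1 - delta on [eps, +oo[ for each eps > 0 (geraghty_gap). Hence
    the inequality above holds with factor 1/2 everywhere and with factor
    (1 - delta) / 2 at pairs at distance at least eps.

    Along an orbit, the step length d (x, f x) never increases, and as long as
    it is at least eps it drops by at least the fixed amount 2 * delta * eps, so
    it tends to 0 (iter_step_small). Two points that f moves very little are
    close to each other, because the inequality with factor (1 - delta) / 2
    would otherwise be violated (almost_fixed_close). These two facts make every
    orbit a Cauchy sequence, and the factor 1/2 alone forces its limit to be
    fixed. *)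

(** Otherwise there are t_n >= eps with beta t_n > 1 - 1/(n+1); then beta t_n
    tends to 1, so t_n would tend to 0. *)
Lemma geraghty_gap (R : realType) (beta : R -> R) (eps : R) :
  geraghty beta -> 0 < eps ->
  exists2 delta : R, 0 < delta & forall t, eps <= t -> beta t <= 1 - delta.
Proof.
move=> [beta01 betaG] eps0; apply: contrapT => nogap.
have /choice[t tP] (n : nat) : exists t, eps <= t /\ 1 - harmonic n <= beta t.
  apply: contrapT => nt; apply: nogap; exists (harmonic n).
    exact: harmonic_gt0.
  move=> t et; rewrite leNgt; apply/negP => /ltW bt.
  by apply: nt; exists t.
have t_ge0 n : 0 <= t n by apply: le_trans (tP n).1; exact: ltW.
have beta_t1 : (beta (t n) @[n --> \oo] --> (1 : R))%classic.
  have h1 : ((1 - harmonic n : R) @[n --> \oo] --> (1 : R))%classic.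
    rewrite -[X in (_ --> X)%classic]subr0.
    by apply: cvgB; [exact: cvg_cst|exact: cvg_harmonic].
  apply: (squeeze_cvgr _ h1 (cvg_cst (1 : R))).
  near=> n; rewrite (tP n).2 /=.
  by have /andP[_ /ltW] := beta01 _ (t_ge0 n).
have /cvgrPdist_lt/(_ _ eps0)[N _ /(_ N (leqnn N))/=] := betaG t t_ge0 beta_t1.
by rewrite sub0r normrN ger0_norm // ltNge (tP N).1.
Unshelve. all: by end_near. Qed.

Lemma step_nonincreasing (R : realType) (X : metricType R) (f : X -> X) :
  (forall x y, mdist (f x) (f y) <= (mdist (f x) y + mdist (f y) x) / 2) ->
  forall x, mdist (f x) (f (f x)) <= mdist x (f x).
Proof.
move=> half x; have := half x (f x).
rewrite mdistxx (metric_sym (f (f x)) x).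
have := metric_triangle x (f x) (f (f x)); lra.
Qed.

(** While the steps of the orbit are at least eps, each is shorter than the
    previous one by at least 2 * delta * eps, which cannot go on forever. *)
Lemma iter_step_small (R : realType) (X : metricType R) (f : X -> X)
    (eps delta : R) :
  (forall x y, mdist (f x) (f y) <= (mdist (f x) y + mdist (f y) x) / 2) ->
  0 < eps -> 0 < delta <= 1 ->
  (forall x y, eps <= mdist x y ->
    mdist (f x) (f y) <= (1 - delta) / 2 * (mdist (f x) y + mdist (f y) x)) ->
  forall x, exists N, forall n, (N <= n)%N ->
    mdist (iter n f x) (f (iter n f x)) < eps.
Proof.
move=> half eps0 /andP[delta0 delta1] strict x.
pose s n := mdist (iter n f x) (f (iter n f x)).
have s_decr n : s n.+1 <= s n by exact: (step_nonincreasing _ _ _ half).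
suff [N sN] : exists N, s N < eps.
  exists N => n /subnK <-; elim: (n - N)%N => [//|m IH].
  exact: le_lt_trans (s_decr _) IH.
apply: contrapT => s_big.
have s_ge n : eps <= s n.
  by rewrite leNgt; apply/negP => sn; apply: s_big; exists n.
have s_drop n : s n.+1 <= s n - 2 * (delta * eps).
  have st : s n.+1 <= (1 - delta) / 2 * (s n + s n.+1).
    apply: le_trans (strict _ _ (s_ge n)) _.
    rewrite mdistxx add0r metric_sym; apply: ler_wpM2l; first by lra.
    exact: metric_triangle.
  have := s_ge n; have := s_ge n.+1; nra.
have s_lin n : s n <= s 0%N - n%:R * (2 * (delta * eps)).
  elim: n => [|n IH]; first by rewrite mul0r subr0.
  by have := s_drop n; rewrite -natr1; lra.
have de0 : 0 < 2 * (delta * eps) by rewrite mulr_gt0 // mulr_gt0.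
have /archi_boundP : 0 <= s 0%N / (2 * (delta * eps)).
  by rewrite divr_ge0 ?mdist_ge0 // ltW.
rewrite ltr_pdivrMr //; set N := Num.Def.archi_bound _.
by have := s_lin N; have := s_ge N; lra.
Qed.

(** Let D = d (x, y) >= eps and let s be the sum of the two displacements. Then
    D - s <= d (f x) (f y) <= (1 - delta) * (D + s / 2), hence delta * D is at
    most 3/2 * s; displacements below delta * eps / 3 exclude this. *)
Lemma almost_fixed_close (R : realType) (X : metricType R) (f : X -> X)
    (eps delta : R) :
  0 < eps -> 0 < delta <= 1 ->
  (forall x y, eps <= mdist x y ->
    mdist (f x) (f y) <= (1 - delta) / 2 * (mdist (f x) y + mdist (f y) x)) ->
  forall x y, mdist x (f x) < delta * eps / 3 ->
    mdist y (f y) < delta * eps / 3 -> mdist x y < eps.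
Proof.
move=> eps0 /andP[delta0 delta1] strict x y sx sy.
rewrite ltNge; apply/negP => Dge; have := strict _ _ Dge.
have t1 := metric_triangle x (f x) y.
have t2 := metric_triangle (f x) (f y) y.
have t3 := metric_triangle (f x) x y.
have t4 := metric_triangle (f y) y x.
rewrite (metric_sym (f y) y) in t2 t4; rewrite (metric_sym (f x) x) in t3.
rewrite (metric_sym y x) in t4.
move: sx sy t1 t2 t3 t4 Dge.
set D := mdist x y; set a := mdist x (f x); set b := mdist y (f y).
set p := mdist (f x) y; set q := mdist (f y) x; set r := mdist (f x) (f y).
move=> sx sy t1 t2 t3 t4 Dge st.
have a0 : 0 <= a by exact: mdist_ge0.
have b0 : 0 <= b by exact: mdist_ge0.
have st' : r <= (1 - delta) / 2 * (2 * D + a + b).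
  by apply: le_trans st _; apply: ler_wpM2l; lra.
have : delta * eps <= delta * D by rewrite ler_pM2l.
have : 0 <= delta * (a + b) by rewrite mulr_ge0 // ?addr_ge0 // ltW.
lra.
Qed.

(** If d (z, f z) were positive, a point x close to z and moved little by f
    would give d (z, f z) <= d (z, f z) / 2 + small. *)
Lemma fixed_of_almost_fixed (R : realType) (X : metricType R) (f : X -> X)
    (z : X) :
  (forall x y, mdist (f x) (f y) <= (mdist (f x) y + mdist (f y) x) / 2) ->
  (forall eps, 0 < eps -> exists2 x, mdist z x < eps & mdist x (f x) < eps) ->
  f z = z.
Proof.
move=> half near_z; apply/eqP; rewrite -[_ == _]negbK -mdist_gt0.
apply/negP => D0.
have [|x zx sx] := near_z (mdist (f z) z / 8); first by rewrite divr_gt0.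
have := half z x.
have := metric_triangle (f z) (f x) z.
have := metric_triangle (f z) z x.
have := metric_triangle (f x) x z.
rewrite (metric_sym (f x) x) (metric_sym x z); lra.
Qed.

Lemma fixed_point_of_strict_gap (R : realType) (X : completeMetricType R)
    (f : X -> X) :
  (forall x y, mdist (f x) (f y) <= (mdist (f x) y + mdist (f y) x) / 2) ->
  (forall eps, 0 < eps -> exists2 delta, 0 < delta <= 1 &
    forall x y, eps <= mdist x y ->
    mdist (f x) (f y) <= (1 - delta) / 2 * (mdist (f x) y + mdist (f y) x)) ->
  exists u : X, f u = u.
Proof.
move=> half strict; pose x n := iter n f (point : X).
have small eps : 0 < eps -> exists N, forall n, (N <= n)%N ->
    mdist (x n) (f (x n)) < eps.
  move=> eps0; have [delta delta01 st] := strict _ eps0.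
  exact: (iter_step_small _ _ _ eps delta).
have x_cauchy : cauchy (x n @[n --> \oo])%classic.
  apply: cauchy_exP => eps eps0.
  have [delta delta01 st] := strict _ eps0.
  have [|N xN] := small (delta * eps / 3).
    by rewrite divr_gt0 // mulr_gt0 //; case/andP: delta01.
  exists (x N), N => // n Nn /=; rewrite ballEmdist /=.
  by apply: (almost_fixed_close _ _ _ _ _ eps0 delta01 st); exact: xN.
have /cvg_ex[z xz] : cvg (x n @[n --> \oo])%classic by exact: cauchy_cvg.
exists z; apply: fixed_of_almost_fixed => // eps eps0.
have [N xN] := small _ eps0.
have /metricType_numDomainType.cvgrPdist_lt/(_ _ eps0)[M _ zM] := xz.
exists (x (maxn M N)); first by apply: zM; exact: leq_maxl.
by apply: xN; exact: leq_maxr.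
Qed.

Theorem corollary2p2 (R : realType) (X : completeMetricType R) (k : nat)
    (T : ('I_k.+1 -> X) -> X) (hT : fisher_geraghty_H T) :
  exists u : X, T (fun=> u) = u.
Proof.
have [beta [betaG contr]] := hT; have [beta01 _] := betaG.
have shrink (c : R) (u v : X) : beta (mdist u v) <= c ->
    mdist (T (fun=> u)) (T (fun=> v)) <=
      c / 2 * (mdist (T (fun=> u)) v + mdist (T (fun=> v)) u).
  move=> bc; apply: le_trans (contr _ _) _.
  by apply: ler_wpM2r; [rewrite addr_ge0 ?mdist_ge0|rewrite ler_pM2r ?invr_gt0].
apply: (fixed_point_of_strict_gap _ _ (fun u => T (fun=> u))) => [u v|eps eps0].
  have /andP[_ /ltW/shrink] := beta01 _ (mdist_ge0 u v).
  by rewrite mul1r mulrC.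
have [delta delta0 gap] := geraghty_gap _ _ _ betaG eps0.
exists delta => [|u v /gap/shrink//].
(* beta takes a nonnegative value on [eps, +oo[, so the gap is at most 1 *)
have /andP[b0 _] := beta01 _ (ltW eps0).
by rewrite delta0 /=; have := gap _ (lexx eps); lra.
Qed.
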